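(* Let $p$ be a prime number and let $\Phi$ be a free metabelian group that is not cyclic. Then there exists a finitely generated subgroup $H \leq \Phi$ such that $H$ is $p'$-isolated in $\Phi$ and $H$ is not $p$-separable in $\Phi$.
   Context: A free metabelian group is a group of the form $F/F''$, where $F$ is a free group (of arbitrary, possibly infinite, rank) and $F''$ is the second commutator subgroup of $F$, i.e. the commutator subgroup of $F'=[F,F]$. Let $p$ be a prime number. A subgroup $H$ of a group $G$ is called $p'$-isolated if for every prime $q \neq p$ and every $g \in G$, the condition $g^q \in H$ implies $g \in H$. A subgroup $H$ of a group $G$ is called $p$-separable (or finitely $p$-separable) if it is separable in the class of finite $p$-groups, that is, if for each $g \in G \setminus H$ there is a homomorphism $\varphi$ from $G$ to some finite $p$-group such that $\varphi(g) \notin \varphi(H)$. *)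

(* Defs.v *)
From HB Require Import structures.
From mathcomp Require Import all_boot all_fingroup all_solvable.
From mathcomp Require Import boolp classical_sets.

Set Implicit Arguments.
Unset Strict Implicit.
Unset Printing Implicit Defensive.

Local Open Scope group_scope.
Local Open Scope classical_set_scope.

(* Groups are arbitrary, possibly infinite, groups [G : groupType]; their
   subgroups are represented by classical sets of elements. *)

Definition is_subgroup (G : groupType) (H : set G) : Prop :=
  [/\ H 1,
      (forall x y, H x -> H y -> H (x * y)) &
      (forall x, H x -> H x^-1)].

Definition subgroup_gen (G : groupType) (A : set G) : set G :=
  smallest (@is_subgroup G) A.

Definition finitely_generated (G : groupType) (H : set G) : Prop :=
  exists s : seq G, H = subgroup_gen [set x | x \in s].

Definition cyclic_group (G : groupType) : Prop :=
  exists x : G, subgroup_gen [set x] = [set: G].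

Definition commutator_subgroup (G : groupType) (A B : set G) : set G :=
  subgroup_gen [set [~ x, y] | x in A & y in B].

Definition derived1 (G : groupType) : set G :=
  commutator_subgroup [set: G] [set: G].
Arguments derived1 : clear implicits.

Definition derived2 (G : groupType) : set G :=
  commutator_subgroup (derived1 G) (derived1 G).
Arguments derived2 : clear implicits.

(* [F] is free on the family [b]: every map from the index type to a group
   extends uniquely to a homomorphism. Injectivity of [b] follows. A
   multiplicative map between groups automatically preserves 1 and inverses. *)
Definition free_on (F : groupType) (X : Type) (b : X -> F) : Prop :=
  forall (G : groupType) (f : X -> G),
    (exists phi : {multiplicative F -> G}, forall x, phi (b x) = f x) /\
    (forall phi psi : {multiplicative F -> G},
       (forall x, phi (b x) = psi (b x)) -> forall w, phi w = psi w).

(* The rank, i.e. the cardinality of [X], is arbitrary. *)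
Definition free_group (F : groupType) : Prop :=
  exists (X : Type) (b : X -> F), free_on b.

(* [Q] is the quotient [G / N]: there is a surjective homomorphism from [G]
   to [Q] whose kernel is [N]. *)
Definition is_quotient (G : groupType) (N : set G) (Q : groupType) : Prop :=
  exists pi : {multiplicative G -> Q},
    (forall y, exists x, pi x = y) /\ [set x | pi x = 1] = N.

Definition free_metabelian (Phi : groupType) : Prop :=
  exists F : groupType, free_group F /\ is_quotient (derived2 F) Phi.

Definition p'_isolated (p : nat) (G : groupType) (H : set G) : Prop :=
  forall q : nat, prime q -> q != p -> forall g : G, H (g ^+ q) -> H g.

Definition p_separable (p : nat) (G : groupType) (H : set G) : Prop :=
  forall g : G, ~ H g ->
    exists (P : finGroupType) (phi : {multiplicative G -> P}),
      p.-group [set: P]%G /\ ~ (phi @` H) (phi g).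

(* Main.v *)
Require Import Defs.
From HB Require Import structures.
From mathcomp Require Import all_boot all_fingroup all_solvable all_order all_algebra.
From mathcomp Require Import boolp classical_sets functions.
From mathcomp Require Import zify ring.

Set Implicit Arguments.
Unset Strict Implicit.
Unset Printing Implicit Defensive.

Import Order.TTheory GRing.Theory Num.Theory.

Local Open Scope group_scope.
Local Open Scope classical_set_scope.

(** Let [a], [b] be two distinct basis elements of [Phi], and let [Phi_2] be the
    subgroup that they generate. Sending [a] to [u |-> u + 1], [b] to
    [u |-> 2 u] and every other basis element to the identity gives an
    action of [Phi] on the rational line by increasing affine maps; on [Phi_2]
    its image is the Baumslag-Solitar group BS(1,2). The subgroup [H] is the
    stabiliser of the point 0 in [Phi_2]; below it is introduced by generators
    ([stab]).

    - It is finitely generated. Write [c = [~ a, b^-1]] and [z = a^-1 c], which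
      fixes 0 because [b a b^-1] acts as [a^2]. Modulo the elements of
      [Phi'] fixing 0, the derived subgroup of [Phi_2] becomes a copy of
      Z[1/2] generated by [c], on which [a] acts trivially and [b^-1]-conjugation
      doubles; three elements of [H] suffice to produce the kernel
      (lemma [delta0_stab]).
    - It is isolated. An increasing affine map one of whose powers fixes 0 fixes
      0. This settles roots lying in [Phi_2]. If [g^q] is in [H] with [g]
      arbitrary, then [g] and its image under the retraction of [Phi] onto
      [Phi_2] have the same [q]-th power, and roots are unique in a free
      metabelian group (lemma [unique_roots]), so [g] lies in [Phi_2].
    - It is not [p]-separable. Since [z] and [a^-1] differ by a commutator, [H]
      and [Phi_2] have the same image in the Frattini quotient of the image of
      [Phi_2] in any finite [p]-group, hence the same image (lemma
      [stab_dense]). But [a] does not fix 0.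

    Uniqueness of roots rests on the Magnus embedding. If [g^q = h^q], then [g]
    and [h] agree in the free abelian quotient, and the difference [u] of their
    Fox derivatives satisfies [u + t u + ... + t^(q-1) u = 0] where [t] is the
    common image. As [u] is a finitely supported function on a torsion-free
    abelian group times the basis, it vanishes; and the Fox derivative together
    with the abelianisation is injective on [Phi] (lemma [fox_injective]). *)

(** * Subgroups and homomorphisms *)

Section Subgroups.
Variable G : groupType.
Implicit Types (A H : set G) (x y : G).

Lemma subgroup_gen_subgroup A : is_subgroup (subgroup_gen A).
Proof.
split=> [K [[]]//|x y Hx Hy K KA|x Hx K KA].
- by case: (KA) => -[_ + _] _; apply; [exact: Hx|exact: Hy].
- by case: (KA) => -[_ _ +] _; apply; exact: Hx.
Qed.

Lemma subgroup_gen_ind A H : is_subgroup H -> A `<=` H -> subgroup_gen A `<=` H.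
Proof. by move=> sH sAH x; apply. Qed.

Lemma subgroup1 H : is_subgroup H -> H 1. Proof. by case. Qed.

Lemma subgroupM H x y : is_subgroup H -> H x -> H y -> H (x * y).
Proof. by case=> _ + _; apply. Qed.

Lemma subgroupV H x : is_subgroup H -> H x -> H x^-1.
Proof. by case=> _ _; apply. Qed.

Lemma subgroupX H x n : is_subgroup H -> H x -> H (x ^+ n).
Proof.
move=> sH Hx; elim: n => [|n IHn]; first exact: subgroup1.
by rewrite expgS; apply: subgroupM.
Qed.

Lemma subgroupJ H x y : is_subgroup H -> H x -> H y -> H (x ^ y).
Proof.
by move=> sH Hx Hy; rewrite /conjg; do 2?apply: (subgroupM sH) => //; exact: subgroupV.
Qed.

Lemma derived1_subgroup : is_subgroup (derived1 G).
Proof. exact: subgroup_gen_subgroup. Qed.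

Lemma derived1R x y : derived1 G [~ x, y].
Proof. by apply: sub_gen_smallest; exists x => //; exists y. Qed.

Lemma derived1J x y : derived1 G x -> derived1 G (x ^ y).
Proof.
move=> Gx; have -> : x ^ y = x * [~ x, y] by rewrite commgEl mulVKg.
by apply: (subgroupM derived1_subgroup) => //; exact: derived1R.
Qed.

End Subgroups.

(** * A basis of a free metabelian group *)

Definition metabelian (G : groupType) : Prop :=
  forall u v : G, derived1 G u -> derived1 G v -> commute u v.

Definition generates (G : groupType) (X : Type) (b : X -> G) : Prop :=
  forall K : set G, is_subgroup K -> (forall x, K (b x)) -> forall g, K g.

(** The existence half of freeness in the variety of metabelian groups; the
    uniqueness half is [generates]. *)
Definition metabelian_extension (G : groupType) (X : Type) (b : X -> G) : Prop :=
  forall (M : groupType) (f : X -> M), metabelian M ->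
    exists phi : {multiplicative G -> M}, forall x, phi (b x) = f x.

Lemma gmulf_is1 (G K : groupType) (f : {multiplicative G -> K}) : f 1 = 1.
Proof. by apply: (mulgI (f 1)); rewrite -gmulfM !mulg1. Qed.

Lemma gmulf_isV (G K : groupType) (f : {multiplicative G -> K}) x :
  f x^-1 = (f x)^-1.
Proof. by apply: (mulgI (f x)); rewrite -gmulfM !mulgV gmulf_is1. Qed.

Lemma gmulf_isX (G K : groupType) (f : {multiplicative G -> K}) x n :
  f (x ^+ n) = f x ^+ n.
Proof.
by elim: n => [|n IHn]; [exact: gmulf_is1|rewrite !expgS gmulfM IHn].
Qed.

Lemma preimage_subgroup (G K : groupType) (f : {multiplicative G -> K}) H :
  is_subgroup H -> is_subgroup (f @^-1` H).
Proof.
case=> H1 HM HV; split=> [|x y|x] /=; first by rewrite gmulf_is1.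
- by rewrite gmulfM; exact: HM.
- by rewrite gmulf_isV; exact: HV.
Qed.

Lemma gmulf_derived1 (G K : groupType) (f : {multiplicative G -> K}) x :
  derived1 G x -> derived1 K (f x).
Proof.
apply: (@subgroup_gen_ind _ _ (f @^-1` derived1 K)).
  exact/preimage_subgroup/derived1_subgroup.
move=> _ [u _ [v _ <-]] /=; rewrite /commg /conjg !gmulfM !gmulf_isV.
exact: derived1R.
Qed.

Lemma gmulf_derived2 (G K : groupType) (f : {multiplicative G -> K}) x :
  metabelian K -> derived2 G x -> f x = 1.
Proof.
move=> mK; apply: (@subgroup_gen_ind _ _ (f @^-1` [set 1])).
  apply: preimage_subgroup; split=> [//|u v /= -> ->|u /= ->].
  - by rewrite mulg1.
  - by rewrite invg1.
move=> _ [u Gu [v Gv <-]] /=; rewrite /commg /conjg !gmulfM !gmulf_isV.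
have := mK _ _ (gmulf_derived1 f Gu) (gmulf_derived1 f Gv).
by move=> /commgP/eqP.
Qed.

(** The carrier of a subgroup as a group in its own right, needed as a target for
    the universal property of a free group. *)
Section SubgroupType.
Variables (G : groupType) (K : set G).
Hypothesis sK : is_subgroup K.

Definition subgroup_type of is_subgroup K := {x : G | `[< K x >]}.
HB.instance Definition _ := Choice.on (subgroup_type sK).
Notation T := (subgroup_type sK).

Definition sub_one : T := exist _ 1 (asboolT (subgroup1 sK)).
Definition sub_mul (x y : T) : T :=
  exist _ (val x * val y)
    (asboolT (subgroupM sK (asboolW (svalP x)) (asboolW (svalP y)))).
Definition sub_inv (x : T) : T :=
  exist _ (val x)^-1 (asboolT (subgroupV sK (asboolW (svalP x)))).

Fact sub_mulA : associative sub_mul.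
Proof. by move=> x y z; apply: val_inj; rewrite /= mulgA. Qed.
Fact sub_mul1 : left_id sub_one sub_mul.
Proof. by move=> x; apply: val_inj; rewrite /= mul1g. Qed.
Fact sub_mulr1 : right_id sub_one sub_mul.
Proof. by move=> x; apply: val_inj; rewrite /= mulg1. Qed.
Fact sub_mulV : left_inverse sub_one sub_inv sub_mul.
Proof. by move=> x; apply: val_inj; rewrite /= mulVg. Qed.
Fact sub_mulrV : right_inverse sub_one sub_inv sub_mul.
Proof. by move=> x; apply: val_inj; rewrite /= mulgV. Qed.

HB.instance Definition _ :=
  isGroup.Build T sub_mulA sub_mul1 sub_mulr1 sub_mulV sub_mulrV.

Definition sub_incl (x : T) : G := val x.
Fact sub_incl_morph : {morph sub_incl : x y / x * y}. Proof. by []. Qed.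
HB.instance Definition _ := isMultiplicative.Build T G sub_incl sub_incl_morph.

End SubgroupType.

(** Map [F] to the subgroup [K] by the universal property and include back into
    [F]: by uniqueness the composite is the identity, so [K] is everything. *)
Lemma free_generates (F : groupType) (X : Type) (b : X -> F) :
  free_on b -> generates b.
Proof.
move=> frF K sK Kb g.
have [[phi phib] _] := frF (subgroup_type sK) (fun x => exist _ (b x) (asboolT (Kb x))).
have [_ uniq] := frF F b.
have fixb x : (@sub_incl _ _ sK \o phi) (b x) = idfun (b x) by rewrite /= phib.
have /= <- := uniq (@sub_incl _ _ sK \o phi) idfun fixb g.
exact: asboolW (svalP (phi g)).
Qed.

(** A homomorphism from [F] to a metabelian group kills [F''], hence factors
    through the quotient [Phi]. *)
Lemma free_metabelian_basis (Phi : groupType) : free_metabelian Phi ->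
  exists (X : Type) (b : X -> Phi),
    [/\ metabelian Phi, generates b & metabelian_extension b].
Proof.
move=> [F [[X [b frF]] [pi [pi_surj ker_pi]]]].
have pi_eq u v (M : groupType) (f : {multiplicative F -> M}) :
    metabelian M -> pi u = pi v -> f u = f v.
  move=> mM Euv; apply: (mulIg (f v)^-1); rewrite mulgV -gmulf_isV -gmulfM.
  apply: gmulf_derived2 => //; rewrite -ker_pi /= gmulfM gmulf_isV Euv.
  exact: mulgV.
exists X, (pi \o b); split.
- have lift u : derived1 Phi u -> exists2 v, derived1 F v & pi v = u.
    apply: (@subgroup_gen_ind _ _ (pi @` derived1 F)).
      split=> [|_ _ [u' Hu' <-] [v' Hv' <-]|_ [u' Hu' <-]].
      - by exists 1; [exact: subgroup1 (@derived1_subgroup F)|rewrite gmulf_is1].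
      - exists (u' * v'); last by rewrite gmulfM.
        exact: (subgroupM (@derived1_subgroup F)).
      - exists u'^-1; last by rewrite gmulf_isV.
        exact: (subgroupV (@derived1_subgroup F)).
    move=> _ [x _ [y _ <-]]; have [x' <-] := pi_surj x; have [y' <-] := pi_surj y.
    exists [~ x', y']; first exact: derived1R.
    by rewrite /commg /conjg !gmulfM !gmulf_isV.
  move=> _ _ /lift[u Fu <-] /lift[v Fv <-]; apply/commgP/eqP.
  have : [set x | pi x = 1] [~ u, v].
    by rewrite ker_pi; apply: sub_gen_smallest; exists u => //; exists v.
  by rewrite /= /commg /conjg !gmulfM !gmulf_isV.
- move=> K sK Kb g; have [x <-] := pi_surj g.
  exact: (free_generates frF (preimage_subgroup pi sK)).
- move=> M f mM; have [[phi phib] _] := frF M f.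
  pose s g := projT1 (cid (pi_surj g)).
  have sE g : pi (s g) = g by rewrite /s; case: cid.
  have psiM : {morph phi \o s : x y / x * y}.
    move=> x y /=; rewrite -gmulfM.
    by apply: pi_eq => //; rewrite gmulfM !sE.
  pose psi : {multiplicative Phi -> M} :=
    HB.pack (phi \o s) (isMultiplicative.Build _ _ (phi \o s) psiM).
  by exists psi => x /=; rewrite -phib; apply: pi_eq => //; rewrite sE.
Qed.

(** Induction on a word in the generators and their inverses, read from left to
    right. *)
Lemma generates_ind (G : groupType) X (b : X -> G) (P : G -> Prop) :
  generates b -> P 1 -> (forall g x, P g -> P (g * b x)) ->
  (forall g x, P g -> P (g * (b x)^-1)) -> forall g, P g.
Proof.
move=> genb P1 PM PV g.
pose K : set G := [set k | forall g, P g -> P (g * k) /\ P (g * k^-1)].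
suff /(_ 1 P1)[] : K g by rewrite mul1g.
apply: (genb K) => [|x h Ph]; last by split; [exact: PM|exact: PV].
split=> [h Ph|x y Kx Ky h Ph|x Kx h Ph].
- by rewrite invg1 mulg1.
- rewrite invgM !mulgA; split; first by case: (Kx _ Ph) => /Ky[].
  by case: (Ky _ Ph) => _ /Kx[].
- by rewrite invgK; case: (Kx _ Ph).
Qed.

(** * Derivations *)

Record linear_action (A C : zmodType) := LinearAction {
  act :> A -> C -> C;
  act0 : forall u, act 0%R u = u;
  actD : forall a b u, act (a + b)%R u = act a (act b u);
  act_add : forall a u v, act a (u + v)%R = (act a u + act a v)%R }.

(** The semidirect product of [C] by [A] is metabelian, as it is an extension of
    one abelian group by another; its homomorphisms encode derivations. *)
Section Semidirect.
Variables (A C : zmodType) (alpha : linear_action A C).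

(* The action is an argument only so that the group structure, which depends on
   it, can be attached to the type. *)
Definition semidirect (beta : linear_action A C) : Type := (A * C)%type.
HB.instance Definition _ (beta : linear_action A C) :=
  Choice.copy (semidirect beta) (A * C)%type.
Notation S := (semidirect alpha).

Definition sd_one : S := (0%R, 0%R).
Definition sd_mul (x y : S) : S := ((x.1 + y.1)%R, (x.2 + alpha x.1 y.2)%R).
Definition sd_inv (x : S) : S := ((- x.1)%R, (alpha (- x.1) (- x.2))%R).

Lemma act_zero a : alpha a 0%R = 0%R.
Proof. by apply: (addrI (alpha a 0%R)); rewrite -act_add !addr0. Qed.

Lemma act_opp a u : alpha a (- u)%R = (- alpha a u)%R.
Proof. by apply: (addrI (alpha a u)); rewrite -act_add !addrN act_zero. Qed.

Fact sd_mulA : associative sd_mul.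
Proof. by move=> x y z; rewrite /sd_mul /= act_add actD !addrA. Qed.
Fact sd_mul1 : left_id sd_one sd_mul.
Proof. by case=> a u; rewrite /sd_mul /= act0 !add0r. Qed.
Fact sd_mulr1 : right_id sd_one sd_mul.
Proof. by case=> a u; rewrite /sd_mul /= act_zero !addr0. Qed.
Fact sd_mulV : left_inverse sd_one sd_inv sd_mul.
Proof. by case=> a u; rewrite /sd_mul /= -act_add !addNr act_zero. Qed.
Fact sd_mulrV : right_inverse sd_one sd_inv sd_mul.
Proof. by case=> a u; rewrite /sd_mul /= -actD addrN act0 addrN. Qed.

HB.instance Definition _ :=
  isGroup.Build S sd_mulA sd_mul1 sd_mulr1 sd_mulV sd_mulrV.

Lemma semidirect_metabelian : metabelian S.
Proof.
have der0 : derived1 S `<=` [set x | x.1 = 0%R].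
  apply: subgroup_gen_ind.
    split=> [//|x y /= x0 y0|x /= x0]; last by rewrite x0 oppr0.
    by rewrite x0 y0 addr0.
  move=> _ [x _ [y _ <-]] /=.
  change (- x.1 + (- y.1 + (x.1 + y.1)) = 0)%R.
  by rewrite addrCA addKr addNr.
move=> [a u] [b v] /der0/= -> /der0/= ->.
change (sd_mul (0, u) (0, v) = sd_mul (0, v) (0, u))%R.
by rewrite /sd_mul /= !act0 [(u + v)%R]addrC.
Qed.

End Semidirect.

Definition single (T : Type) (t : T) : T -> int :=
  fun s => if `[< t = s >] then 1%R else 0%R.

Section Derivations.
Variables (G : groupType) (X : Type) (b : X -> G).
Hypotheses (genb : generates b) (extb : metabelian_extension b).

(** [e g x] is the exponent sum of [b x] in [g]: this is the abelianisation of
    [G], seen inside the group of all functions from the basis to the integers. *)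
Definition is_exponent (e : G -> X -> int) :=
  (forall x, e (b x) = single x) /\ (forall g h, e (g * h) = (e g + e h)%R).

Lemma exponent_exists : exists e, is_exponent e.
Proof.
pose alpha : linear_action (X -> int : zmodType) (int : zmodType) :=
  @LinearAction (X -> int) int (fun _ u => u) (fun _ => erefl) (fun _ _ _ => erefl)
    (fun _ _ _ => erefl).
have [phi phib] := extb (fun x => ((single x, 0%R) : semidirect alpha))
  (@semidirect_metabelian _ _ alpha).
exists (fun g => (phi g).1); split=> [x|g h]; first by rewrite phib.
by rewrite gmulfM.
Qed.

Variable e : G -> X -> int.
Hypothesis expe : is_exponent e.

Lemma exponent1 : e 1 = 0%R.
Proof. by apply: (addrI (e 1)); rewrite -(proj2 expe) mulg1 addr0. Qed.

Lemma exponentV g : e g^-1 = (- e g)%R.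
Proof. by apply: (addrI (e g)); rewrite -(proj2 expe) mulgV exponent1 addrN. Qed.

Definition is_derivation (C : zmodType) (alpha : linear_action (X -> int : zmodType) C)
    (d : X -> C) (D : G -> C) : Prop :=
  (forall x, D (b x) = d x) /\
  (forall g h, D (g * h) = (D g + alpha (e g) (D h))%R).

(** A derivation is the second component of a homomorphism to the semidirect
    product whose first component is the exponent, so it may be prescribed
    freely on a basis. *)
Lemma derivation_exists (C : zmodType) (alpha : linear_action (X -> int : zmodType) C)
    (d : X -> C) :
  exists D, is_derivation alpha d D.
Proof.
have [phi phib] := extb (fun x => ((single x, d x) : semidirect alpha))
  (@semidirect_metabelian _ _ alpha).
have phi1 g : (phi g).1 = e g.
  move: g; apply: (generates_ind genb) => [|g x IHg|g x IHg].
  - by rewrite gmulf_is1 exponent1.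
  - by rewrite gmulfM (proj2 expe) (proj1 expe) -IHg phib.
  - by rewrite gmulfM (proj2 expe) exponentV (proj1 expe) -IHg gmulf_isV phib.
exists (fun g => (phi g).2); split=> [x|g h]; first by rewrite phib.
by rewrite gmulfM /= -phi1.
Qed.

End Derivations.

(** * Words *)

Section Words.
Variables (G : groupType) (T : Type) (v : T -> G).

Definition letter (l : T * bool) : G := if l.2 then v l.1 else (v l.1)^-1.
Definition word (L : seq (T * bool)) : G := \prod_(l <- L) letter l.
Definition sign_of (b : bool) : int := if b then 1%R else (- 1)%R.

Lemma word_cons l L : word (l :: L) = letter l * word L.
Proof. exact: big_cons. Qed.

Lemma word_cat L1 L2 : word (L1 ++ L2) = word L1 * word L2.
Proof. exact: big_cat. Qed.

Lemma letterN t b : letter (t, ~~ b) = (letter (t, b))^-1.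
Proof. by case: b; rewrite /letter //= invgK. Qed.

End Words.

Section Weights.
Variable T : Type.

Definition weight (L : seq (T * bool)) : T -> int :=
  fun t => (\sum_(l <- L) single l.1 t * sign_of l.2)%R.

Lemma weight_cons l L t : weight (l :: L) t = (single l.1 t * sign_of l.2 + weight L t)%R.
Proof. exact: big_cons. Qed.

Lemma weight_cat L1 L2 t : weight (L1 ++ L2) t = (weight L1 t + weight L2 t)%R.
Proof. exact: big_cat. Qed.

(** If [(t, b)] does not occur in [L], then all occurrences of [t] carry the
    opposite sign, whence the inequality. *)
Lemma weight_split L t (b : bool) :
  (exists L1 L2, L = L1 ++ (t, b) :: L2) \/ (0 <= sign_of (~~ b) * weight L t)%R.
Proof.
elim: L => [|[s c] L [[L1 [L2 ->]]|IHL]].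
- by right; rewrite /weight big_nil mulr0.
- by left; exists ((s, c) :: L1), L2.
- rewrite weight_cons /single /=; case: asboolP => [->|_]; last first.
    by right; rewrite mul0r add0r.
  have [->|] := eqVneq c b; first by left; exists [::], L.
  by move=> ncb; right; move: IHL ncb; case: b; case: c; rewrite /sign_of //=; lia.
Qed.

End Weights.

(** Words of zero weight vanish in an abelian group: the first letter has a
    cancelling occurrence further on, and moving one next to the other costs a
    commutator. The relative form, modulo [N], serves both for the
    abelianisation of [G] and for its derived subgroup. *)
Lemma word_weight0 (G : groupType) (T : Type) (v : T -> G) (K N : set G) :
    is_subgroup K -> is_subgroup N -> (forall t, K (v t)) ->
    (forall x y, K x -> K y -> N [~ x, y]) ->
  forall L, (forall t, weight L t = 0%R) -> N (word v L).
Proof.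
move=> sK sN Kv KN L.
have Kl l : K (letter v l) by rewrite /letter; case: ifP => // _; exact: subgroupV.
have Kw L' : K (word v L').
  elim: L' => [|l L' IHL]; first by rewrite /word big_nil; exact: subgroup1.
  by rewrite word_cons; exact: subgroupM.
move: {2}(size L) (leqnn (size L)) => n; elim: n L => [|n IHn] [|[t b] L] //.
- by move=> _ _; rewrite /word big_nil; exact: subgroup1.
- by move=> _ _; rewrite /word big_nil; exact: subgroup1.
rewrite /= ltnS => sL w0.
have [[L1 [L2 EL]]|] := weight_split L t (~~ b); last first.
  move: (w0 t); rewrite weight_cons /single /= asboolT //.
  by case: (b); rewrite /sign_of /=; lia.
have {w0} w0 s : weight (L1 ++ L2) s = 0%R.
  move: (w0 s); rewrite EL weight_cons !weight_cat weight_cons /=.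
  by case: (b); rewrite /sign_of /=; lia.
have {}IHn : N (word v (L1 ++ L2)).
  by apply: IHn => //; move: sL; rewrite EL !size_cat /=; lia.
rewrite EL word_cons word_cat word_cons letterN.
set x := letter _ _; set y := word v L1.
have -> : x * (y * (x^-1 * word v L2)) = [~ x^-1, y^-1] * word v (L1 ++ L2).
  by rewrite word_cat /commg /conjg !invgK -!mulgA mulKg.
apply: (subgroupM sN) => //.
by apply: KN; apply: (subgroupV sK); [exact: Kl|exact: Kw].
Qed.

(** * The Magnus embedding and uniqueness of roots *)

Section FoxCalculus.
Variables (G : groupType) (X : Type) (b : X -> G).
Hypotheses (mG : metabelian G) (genb : generates b).
Variable e : G -> X -> int.
Hypothesis expe : is_exponent b e.

Lemma derivation_1 (C : zmodType) (alpha : linear_action (X -> int : zmodType) C) d D :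
  is_derivation b e alpha d D -> D 1 = 0%R.
Proof.
case=> _ DM; apply: (addrI (D 1)).
by rewrite addr0 -[in RHS](mulg1 1) DM (exponent1 expe) act0.
Qed.

Lemma derivation_V (C : zmodType) (alpha : linear_action (X -> int : zmodType) C) d D g :
  is_derivation b e alpha d D -> D g^-1 = (- alpha (- e g) (D g))%R.
Proof.
move=> derD; apply/eqP; rewrite -subr_eq0 opprK; apply/eqP.
by rewrite -(exponentV expe) -(proj2 derD) mulVg (derivation_1 derD).
Qed.

Lemma basis_word g : exists L, g = word b L.
Proof.
move: g; apply: (generates_ind genb) => [|_ x [L ->]|_ x [L ->]].
- by exists [::]; rewrite /word big_nil.
- by exists (L ++ [:: (x, true)]); rewrite word_cat /word big_seq1.
- by exists (L ++ [:: (x, false)]); rewrite word_cat /word big_seq1.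
Qed.

Lemma exponent_word L : e (word b L) = weight L.
Proof.
elim: L => [|[x c] L IHL].
  by rewrite /word big_nil (exponent1 expe); apply/funext => t; rewrite /weight big_nil.
apply/funext => t; rewrite word_cons weight_cons (proj2 expe) -IHL.
congr (_ + _)%R; rewrite /letter /=; case: c; last first.
  by rewrite (exponentV expe) (proj1 expe) /sign_of mulrN1.
by rewrite (proj1 expe) /sign_of mulr1.
Qed.

Lemma exponent0_derived g : e g = 0%R -> derived1 G g.
Proof.
have [L ->] := basis_word g; rewrite exponent_word => w0.
apply: (word_weight0 (K := setT)) => //; first exact: derived1_subgroup.
- by move=> x y _ _; exact: derived1R.
- by move=> t; rewrite w0.
Qed.

(** The edge of the Cayley graph of the abelianisation that starts at [a] and is
    labelled by [x] is the pair [(a, x)]. Integer functions on edges stand for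
    1-chains. *)
Definition edge : Type := ((X -> int) * X)%type.

Definition shift (a : X -> int) (u : edge -> int) : edge -> int :=
  fun t => u ((t.1 - a)%R, t.2).

Fact shift0 u : shift 0%R u = u.
Proof. by apply/funext => -[a x]; rewrite /shift /= subr0. Qed.

Fact shiftD a c u : shift (a + c)%R u = shift a (shift c u).
Proof. by apply/funext => -[a' x]; rewrite /shift /= opprD addrA. Qed.

Fact shift_add a u v : shift a (u + v)%R = (shift a u + shift a v)%R.
Proof. by []. Qed.

Definition shift_action : linear_action (X -> int : zmodType) (edge -> int : zmodType) :=
  @LinearAction (X -> int) (edge -> int) shift shift0 shiftD shift_add.

Lemma shift_single a c x : shift a (single (c, x)) = single ((c + a)%R, x).
Proof.
apply/funext => -[c' x']; rewrite /shift /single /=; congr (if _ then _ else _).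
by apply: asbool_equiv_eq; split=> [[-> ->]|[<- ->]]; rewrite ?subrK ?addrK.
Qed.

(** [D g] is the 1-chain of the path that a word for [g] traces from the origin
    in the Cayley graph; its components are the Fox derivatives of [g]. *)
Definition is_fox := is_derivation b e shift_action (fun x => single (0%R, x)).

Variable D : G -> edge -> int.
Hypothesis foxD : is_fox D.

(** The Reidemeister-Schreier rewriting process: relative to a section [s] of the
    abelianisation, an element of the kernel is a product of the elements
    [rho t], one for each edge [t] of its path, counted with sign. *)
Lemma fox_word (s : (X -> int) -> G) : (forall g, e (s (e g)) = e g) ->
  exists rho : edge -> G, (forall t, e (rho t) = 0%R) /\
    forall g, exists L, D g = weight L /\ s 0%R * g * (s (e g))^-1 = word rho L.
Proof.
move=> es.
(* Vertices outside the image of [e] carry a meaningless [s], so the value there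
   is replaced by 1 to keep [rho] in the kernel of [e]. *)
pose k g := if `[< e g = 0%R >] then g else 1.
have kE g : e g = 0%R -> k g = g by move=> g0; rewrite /k asboolT.
pose rho (t : edge) := k (s t.1 * b t.2 * (s (t.1 + single t.2)%R)^-1).
exists rho; split.
  by move=> t; rewrite /rho /k; case: asboolP => // _; exact: (exponent1 expe).
have rhoE g x : rho (e g, x) = s (e g) * b x * (s (e (g * b x)))^-1.
  have Ex : (e g + single x)%R = e (g * b x) by rewrite (proj2 expe) (proj1 expe).
  have eMMV u v w : e (u * v * w^-1) = (e u + e v - e w)%R.
    by rewrite !(proj2 expe) (exponentV expe).
  by rewrite /rho /= Ex kE // eMMV !es (proj2 expe) addrN.
apply: (generates_ind genb) => [|g x [L [DL wL]]|g x [L [DL wL]]].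
- exists [::]; rewrite (derivation_1 foxD) /word big_nil (exponent1 expe) mulg1 mulgV.
  by split=> //; apply/funext => t; rewrite /weight big_nil.
- exists (L ++ [:: ((e g, x), true)]); split.
    rewrite (proj2 foxD) (proj1 foxD) -[shift_action _ _]/(shift _ _).
    rewrite shift_single add0r DL; apply/funext => t.
    by rewrite weight_cat /weight big_seq1 /sign_of mulr1.
  by rewrite word_cat -wL /word big_seq1 /letter /= rhoE !mulgA mulgVK.
- exists (L ++ [:: ((e (g * (b x)^-1), x), false)]); split.
    rewrite (proj2 foxD) (derivation_V _ foxD) (proj1 foxD) act_opp -actD.
    rewrite -[shift_action _ _]/(shift _ _) shift_single add0r -(exponentV expe).
    rewrite -(proj2 expe) DL; apply/funext => t.
    by rewrite weight_cat /weight big_seq1 /sign_of mulrN1.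
  rewrite word_cat -wL /word big_seq1 /letter /= rhoE mulgVK !invgM !invgK !mulgA.
  by rewrite mulgVK.
Qed.

Lemma exponent_section : exists s : (X -> int) -> G, forall g, e (s (e g)) = e g.
Proof.
have pick a : exists h, (exists g, e g = a) -> e h = a.
  have [[h <-]|noh] := pselect (exists g, e g = a); first by exists h.
  by exists 1 => /noh.
exists (fun a => projT1 (cid (pick a))) => h.
by case: cid => k /=; apply; exists h.
Qed.

(** If the 1-chain of [g] is zero, then the rewritten form of [g] is a word of
    weight zero in elements of the derived subgroup, which is abelian. *)
Lemma fox_injective g : e g = 0%R -> D g = 0%R -> g = 1.
Proof.
move=> g0 Dg0.
have [s es] := exponent_section.
have [rho [e_rho /(_ g)[L [DL wL]]]] := fox_word es.
have : word rho L = 1.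
  apply: (word_weight0 (K := [set h | e h = 0%R]) (N := [set 1])) => //.
  - split=> [|x y /= x0 y0|x /= x0]; first exact: (exponent1 expe).
    + by rewrite (proj2 expe) x0 y0 addr0.
    + by rewrite (exponentV expe) x0 oppr0.
  - by split=> [//|x y /= -> ->|x /= ->]; rewrite ?mulg1 ?invg1.
  - move=> x y /= /exponent0_derived Gx /exponent0_derived Gy.
    by apply/eqP/commgP; exact: mG.
  - by move=> t; rewrite -DL Dg0.
rewrite -wL g0 => sgs.
by apply: (mulgI (s 0%R)); apply: (mulIg (s 0%R)^-1); rewrite sgs mulg1 mulgV.
Qed.

(** The chain of a path is supported on the edges of the path, which are finitely
    many; a bound in the direction of one basis element is all that is needed. *)
Lemma fox_bounded g x : exists B : nat, forall t, D g t != 0%R -> (`|t.1 x| <= B)%N.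
Proof.
have [s es] := exponent_section.
have [rho [_ /(_ g)[L [-> _]]]] := fox_word es.
exists (\sum_(l <- L) `|l.1.1 x|)%N => t.
elim: L => [|[[a y] c] L IHL]; first by rewrite /weight !big_nil eqxx.
rewrite weight_cons big_cons /single /=; case: asboolP => [<- _|_].
  exact: leq_addr.
by rewrite mul0r add0r => /IHL/leq_trans; apply; exact: leq_addl.
Qed.

(** The difference [u] of the two chains has sum zero over [q] consecutive
    translates by [t = e g = e h]. If [t = 0] this says [q u = 0]. Otherwise [u]
    is invariant under translation by [q t], which moves any point of its
    support out of every bounded strip. *)
Lemma unique_roots (g h : G) q : (0 < q)%N -> g ^+ q = h ^+ q -> g = h.
Proof.
move=> q_gt0 Egh.
have e_exp k n x : e (k ^+ n) x = (e k x *+ n)%R.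
  elim: n => [|n IHn]; first by rewrite expg0 (exponent1 expe) mulr0n.
  by rewrite expgS (proj2 expe) mulrS -IHn.
have Ee : e g = e h.
  apply/funext => x; have := congr1 (fun k => e k x) Egh; rewrite /= !e_exp.
  by move=> /eqP; rewrite -subr_eq0 -mulrnBl mulrn_eq0 gtn_eqF //= subr_eq0 => /eqP.
pose u := (D g - D h)%R; pose S n := (D (g ^+ n) - D (h ^+ n))%R.
have e_pow n : e (g ^+ n) = e (h ^+ n) by apply/funext => x; rewrite !e_exp Ee.
(* [g^(n+1)] is expanded as [g g^n], then as [g^n g]; comparing the two at [n = q]
   is the telescoping of the geometric sum. *)
have SS n : S n.+1 = (u + shift (e g) (S n))%R.
  rewrite /S !expgS !(proj2 foxD) -Ee.
  by rewrite opprD addrACA.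
have SSr n : S n.+1 = (S n + shift (e (g ^+ n)) u)%R.
  rewrite /S !expgSr !(proj2 foxD) -e_pow.
  by rewrite opprD addrACA.
have Sq : S q = 0%R by rewrite /S Egh subrr.
have u0 : u = 0%R; last first.
  have Dgh : D g = D h by apply/eqP; rewrite -subr_eq0; apply/eqP.
  apply: (mulgI h^-1); rewrite mulVg; apply: fox_injective.
    by rewrite (proj2 expe) (exponentV expe) Ee addNr.
  by rewrite (proj2 foxD) Dgh -(proj2 foxD) mulVg (derivation_1 foxD).
have inv_u : shift (e (g ^+ q)) u = u.
  have := SSr q; rewrite SS Sq add0r => <-.
  by rewrite -[RHS]addr0; congr (_ + _)%R.
apply/funext => t; apply/eqP/negPn/negP => ut.
have [g0|/existsNP[x gx]] := pselect (forall x, e g x = 0%R).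
  have Sn n : S n = (u *+ n)%R.
    elim: n => [|n IHn]; first by rewrite /S !expg0 subrr.
    have -> : S n.+1 = (S n + u)%R.
      rewrite SSr; congr (_ + _)%R; rewrite -[RHS]shift0; congr (shift _ u).
      by apply/funext => x; rewrite e_exp g0 mul0rn.
    by rewrite IHn mulrSr.
  have /eqP := congr1 (fun f => f t) Sq; rewrite Sn /= natmulfctE.
  by rewrite mulrn_eq0 gtn_eqF //= (negPf ut).
have [Bg Bg_le] := fox_bounded g x; have [Bh Bh_le] := fox_bounded h x.
have u_le s : u s != 0%R -> (`|s.1 x| <= maxn Bg Bh)%N.
  rewrite /u !fctE /=; have [Dg0|/Bg_le] := eqVneq (D g s) 0%R; last by lia.
  have [Dh0|/Bh_le] := eqVneq (D h s) 0%R; last by lia.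
  by rewrite Dg0 Dh0 subrr eqxx.
have u_inv n : u t = u ((t.1 - e (g ^+ q) *+ n)%R, t.2).
  elim: n => [|n ->]; first by rewrite mulr0n subr0; case: (t).
  by rewrite -{1}inv_u /shift /= -addrA -opprD -mulrSr.
have := u_inv (maxn Bg Bh + `|t.1 x|).+1; set n := _.+1 => ut_n.
move: ut; rewrite ut_n => /u_le /=.
rewrite !fctE natmulfctE e_exp.
have : (n <= `|(e g x *+ q *+ n)%R|)%N.
  rewrite -(mulr_natr (e g x *+ q)%R) natz abszM leq_pmull // absz_gt0.
  by rewrite mulrn_eq0 gtn_eqF //=; exact/eqP.
by rewrite /n; lia.
Qed.
End FoxCalculus.

(** * A point stabiliser in an affine action *)

Section Stabiliser.
Variable G : groupType.
Hypothesis mG : metabelian G.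
Variables a b : G.

(** The element by which [b a b^-1] differs from [a]: [b a b^-1 = a * twist]. *)
Definition twist : G := [~ a, b^-1].
(** In the action [a : u |-> u + 1], [b : u |-> 2 u] the element [twist] acts as
    [a], so that [a^-1 * twist] and its conjugate by [a] fix every point. *)
Definition stab_gens : seq G := [:: b; a^-1 * twist; (a^-1 * twist) ^ a^-1].
Definition stab : set G := subgroup_gen [set x | x \in stab_gens].

Let c := twist.
Let z := a^-1 * c.
Let H := stab.
Let H' : set G := H `&` derived1 G.

Lemma stab_subgroup : is_subgroup stab.
Proof. exact: subgroup_gen_subgroup. Qed.
Let sH := stab_subgroup.
Let sG' := @derived1_subgroup G.

Lemma stab_gen x : x \in stab_gens -> stab x.
Proof. by move=> x_gen; apply: sub_gen_smallest. Qed.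

Lemma stab_b : H b.
Proof. by apply: stab_gen; rewrite inE eqxx. Qed.

Lemma stab_z : H z.
Proof. by apply: stab_gen; rewrite !inE eqxx orbT. Qed.

Let Gc : derived1 G c. Proof. exact: derived1R. Qed.

Let core_subgroup : is_subgroup H'.
Proof.
split=> [|x y [Hx Gx] [Hy Gy]|x [Hx Gx]]; split.
- exact: (subgroup1 sH).
- exact: (subgroup1 sG').
- exact: (subgroupM sH).
- exact: (subgroupM sG').
- exact: (subgroupV sH).
- exact: (subgroupV sG').
Qed.

Lemma derived_conj u v : derived1 G u -> derived1 G v -> u ^ v = u.
Proof. by move=> Gu Gv; apply/conjg_fixP/commgP; exact: mG. Qed.

Lemma derived_conj_swap u x y : derived1 G u -> u ^ (x * y) = u ^ (y * x).
Proof.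
move=> Gu; rewrite [x * y]commgC conjgM derived_conj //; last exact: derived1R.
exact: derived1J.
Qed.

Let core_J x h : H' x -> H h -> H' (x ^ h).
Proof. by move=> [Hx Gx] Hh; split; [exact: (subgroupJ sH)|exact: derived1J]. Qed.

(** [H] need not contain [a], but [z] acts on the abelian group [derived1 G] as
    [a^-1] does; so [H'] is normalised by [a] as well as by [b]. *)
Let core_Ja x : H' x -> H' (x ^ a).
Proof.
move=> Hx; have -> : x ^ a = x ^ z^-1.
  rewrite /z invgM invgK conjgM; congr (_ ^ _); rewrite derived_conj //.
    by case: Hx.
  exact: (subgroupV sG').
exact: (core_J Hx (subgroupV sH stab_z)).
Qed.

Let core_JaV x : H' x -> H' (x ^ a^-1).
Proof.
move=> Hx; have -> : x ^ a^-1 = x ^ z.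
  by case: Hx => _ Gx; rewrite /z conjgM [RHS]derived_conj //; exact: derived1J.
exact: (core_J Hx stab_z).
Qed.

Let conj_a u : u ^ a = u * [~ u, a]. Proof. by rewrite commgEl mulVKg. Qed.

(** Modulo [H'], conjugation by [a] fixes [c]. This is what the third generator
    is for. *)
Let core_ca : H' [~ c, a].
Proof.
have Hw : H (z ^ a^-1) by apply: stab_gen; rewrite !inE eqxx !orbT.
suff Ew : [~ c, a]^-1 = z ^ a^-1 * z^-1.
  split; last exact: derived1R.
  rewrite -[[~ c, a]]invgK Ew; apply: (subgroupV sH).
  by apply: (subgroupM sH) => //; exact: (subgroupV sH stab_z).
rewrite commgEl invgM invgK (mG _ Gc); last exact: (subgroupV sG' (derived1J _ Gc)).
by rewrite /z /conjg; move: (c) => u; rewrite !invgM !invgK !mulgA mulgV mul1g.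
Qed.

Lemma derived_mulACA x y x' y' : derived1 G y -> derived1 G x' ->
  (x * y) * (x' * y') = (x * x') * (y * y').
Proof. by move=> Gy Gx'; rewrite !mulgA -(mulgA x) (mG Gy Gx') mulgA. Qed.

Let Gpow n : derived1 G (c ^+ n). Proof. exact: (subgroupX _ sG'). Qed.
Let GpowV n : derived1 G (c ^- n). Proof. exact: (subgroupV sG'). Qed.

(** The preimage of the cyclic group generated by [c] in the quotient of
    [derived1 G] by [H']. *)
Let E : set G := [set u | exists v i j, H' v /\ u = v * (c ^+ i * c ^- j)].

Let E_core v : H' v -> E v.
Proof. by move=> Hv; exists v, 0%N, 0%N; rewrite !expg0 invg1 !mulg1. Qed.

Let E_c : E c.
Proof.
exists 1, 1%N, 0%N; rewrite expg0 expg1 invg1 mulg1 mul1g; split=> //.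
exact: (subgroup1 core_subgroup).
Qed.

Let E_subgroup : is_subgroup E.
Proof.
split=> [|_ _ [v [i [j [Hv ->]]]] [v' [i' [j' [Hv' ->]]]]|_ [v [i [j [Hv ->]]]]].
- exact: E_core (subgroup1 core_subgroup).
- exists (v * v'), (i + i')%N, (j + j')%N; split; first exact: (subgroupM core_subgroup).
  have [_ Gv'] := Hv'.
  rewrite derived_mulACA //; last exact: (subgroupM sG').
  by congr (_ * _); rewrite derived_mulACA // -invgM -!expgnDr [(j' + j)%N]addnC.
- exists v^-1, j, i; split; first exact: (subgroupV core_subgroup).
  have [_ Gv] := Hv.
  rewrite invgM invgM invgK; apply: mG; first exact: (subgroupM sG').
  exact: (subgroupV sG').
Qed.

(** Modulo [H'], conjugation by [b^-1] doubles [c]: this is [z ^ b^-1 * z^-1],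
    corrected by the preceding lemmas. *)
Let core_cb : H' (c^-1 * (c ^ b^-1 * c^-1)).
Proof.
have Gcb : derived1 G (c ^ b^-1) by exact: derived1J.
have Gf : derived1 G (c ^ b^-1 * c^-1).
  by apply: (subgroupM sG') => //; exact: (subgroupV sG').
have Hf : H' (c^-1 * (c ^ b^-1 * c^-1) ^ a).
  split; last by apply: (subgroupM sG'); [exact: (subgroupV sG')|exact: derived1J].
  have -> : c^-1 * (c ^ b^-1 * c^-1) ^ a = z ^ b^-1 * z^-1.
    have ab : a ^ b^-1 = a * c by rewrite /c /twist commgEl mulVKg.
    have -> : z ^ b^-1 = (a * c)^-1 * c ^ b^-1 by rewrite /z conjMg conjVg ab.
    rewrite /z; move: (c) => u.
    by rewrite /conjg !invgM !invgK !mulgA.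
  apply: (subgroupM sH); last exact: (subgroupV sH stab_z).
  apply: (subgroupJ sH stab_z); exact: (subgroupV sH stab_b).
suff /core_JaV : H' ((c^-1 * (c ^ b^-1 * c^-1)) ^ a) by rewrite conjgK.
rewrite conjMg conjVg (conj_a c) invgM -mulgA; apply: (subgroupM core_subgroup) => //.
exact: (subgroupV core_subgroup core_ca).
Qed.

Let E_Jb u : E u -> E (u ^ b^-1).
Proof.
have E_cb : E (c ^ b^-1).
  have -> : c ^ b^-1 = c * (c^-1 * (c ^ b^-1 * c^-1)) * c by rewrite mulKVg mulgVK.
  do 2?apply: (subgroupM E_subgroup) => //; exact: E_core core_cb.
move=> [v [i [j [Hv ->]]]]; rewrite conjMg conjMg conjVg !conjXg.
apply: (subgroupM E_subgroup); last apply: (subgroupM E_subgroup).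
- by apply: E_core; apply: core_J => //; exact: (subgroupV sH stab_b).
- exact: (subgroupX _ E_subgroup).
- by apply: (subgroupV E_subgroup); exact: (subgroupX _ E_subgroup).
Qed.

Let E_Jbn u n : E u -> E (u ^ (b ^- n)).
Proof.
move=> Eu; elim: n => [|n IHn]; first by rewrite expg0 invg1 conjg1.
by rewrite expgS invgM conjgM; exact: E_Jb.
Qed.

(** Modulo [H'], the elements [u] that conjugation by some power of [b] turns
    into a power of [c] and that [a] fixes: a copy of Z[1/2]. Being fixed by [a]
    is required so that [D] is stable under conjugation by [a]. *)
Let D : set G := [set u | [/\ derived1 G u, H' [~ u, a] & exists n, E (u ^ (b ^- n))]].

Let D_core v : H' v -> D v.
Proof.
move=> Hv; split; first by case: Hv.
  rewrite commgEl; apply: (subgroupM core_subgroup); last exact: core_Ja.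
  exact: (subgroupV core_subgroup).
by exists 0%N; rewrite expg0 invg1 conjg1; exact: E_core.
Qed.

Let D_c : D c.
Proof. by split=> //; exists 0%N; rewrite expg0 invg1 conjg1. Qed.

Let D_subgroup : is_subgroup D.
Proof.
split=> [|u u' [Gu Ha [n En]] [Gu' Ha' [n' En']]|u [Gu Ha [n En]]].
- exact: D_core (subgroup1 core_subgroup).
- split; first exact: (subgroupM sG').
    suff -> : [~ u * u', a] = [~ u, a] * [~ u', a] by exact: (subgroupM core_subgroup).
    rewrite !commgEl conjMg invgM (mG (subgroupV sG' Gu') (subgroupV sG' Gu)).
    by rewrite derived_mulACA //; [exact: (subgroupV sG')|exact: derived1J].
  exists (n + n')%N; rewrite conjMg; apply: (subgroupM E_subgroup).
    by rewrite addnC expgnDr invgM conjgM; exact: E_Jbn.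
  by rewrite expgnDr invgM conjgM; exact: E_Jbn.
- split; first exact: (subgroupV sG').
    suff -> : [~ u^-1, a] = [~ u, a]^-1 by exact: (subgroupV core_subgroup).
    rewrite !commgEl invgM !invgK conjVg; apply: mG => //.
    by apply: (subgroupV sG'); exact: derived1J.
  by exists n; rewrite conjVg; exact: (subgroupV E_subgroup).
Qed.

Let D_Ja u : D u -> D (u ^ a).
Proof.
move=> Du; rewrite conj_a; apply: (subgroupM D_subgroup) => //.
by apply: D_core; case: Du.
Qed.

Let D_JaV u : D u -> D (u ^ a^-1).
Proof.
move=> Du; have [_ /core_JaV Ha _] := Du.
have -> : u ^ a^-1 = u * ([~ u, a] ^ a^-1)^-1.
  by rewrite commgEl conjMg conjgK conjVg invgM invgK mulKVg.
apply: (subgroupM D_subgroup) => //.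
by apply: D_core; exact: (subgroupV core_subgroup).
Qed.

Let D_Jb' u k : H k -> D u -> H' [~ u ^ k, a].
Proof.
move=> Hk [Gu Ha _].
suff -> : [~ u ^ k, a] = [~ u, a] ^ k by exact: core_J.
rewrite [in RHS]commgEl [RHS]conjMg conjVg -conjgM.
by rewrite derived_conj_swap // conjgM commgEl.
Qed.

Let D_JbV u : D u -> D (u ^ b^-1).
Proof.
move=> Du; split; first by case: Du => Gu _ _; exact: derived1J.
  by apply: D_Jb' => //; exact: (subgroupV sH stab_b).
have [_ _ [n /E_Jb En]] := Du; exists n.
by rewrite -conjgM -invgM -expgSr expgS invgM conjgM.
Qed.

Let D_Jb u : D u -> D (u ^ b).
Proof.
move=> Du; split; first by case: Du => Gu _ _; exact: derived1J.
  by apply: D_Jb' => //; exact: stab_b.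
have [_ _ [n En]] := Du; exists n.+1.
by rewrite expgSr invgM -conjgM mulKVg.
Qed.

(** The subgroup generated by [a] and [b] is contained in [H * D]: [z] can
    replace [a^-1] up to an element of [D]. *)
Let T : set G := [set g | exists h d, [/\ H h, D d & g = h * d]].

Let T1 : T 1.
Proof.
exists 1, 1; rewrite mulg1; split=> //; first exact: (subgroup1 sH).
exact: (subgroup1 D_subgroup).
Qed.

Let T_all g : subgroup_gen [set x | x = a \/ x = b] g -> T g.
Proof.
pose K : set G := [set k | forall g, T g -> T (g * k) /\ T (g * k^-1)].
suff sK : subgroup_gen [set x | x = a \/ x = b] `<=` K.
  by move=> /sK /(_ 1 T1)[]; rewrite mul1g.
apply: subgroup_gen_ind.
  split=> [h Th|x y Kx Ky h Th|x Kx h Th].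
  - by rewrite invg1 mulg1.
  - rewrite invgM !mulgA; split; first by case: (Kx _ Th) => /Ky[].
    by case: (Ky _ Th) => _ /Kx[].
  - by rewrite invgK; case: (Kx _ Th).
move=> _ [->|->] _ [h [d [Hh Dd ->]]]; split.
- exists (h * z^-1), (c ^ a * d ^ a); split.
  + by apply: (subgroupM sH) => //; exact: (subgroupV sH stab_z).
  + by apply: (subgroupM D_subgroup); apply: D_Ja.
  + by rewrite /z /conjg; move: (c) => u; rewrite invgM invgK !mulgA !(mulgK, mulgVK).
- exists (h * z), (c^-1 * d ^ a^-1); split.
  + by apply: (subgroupM sH) => //; exact: stab_z.
  + by apply: (subgroupM D_subgroup); [exact: (subgroupV D_subgroup)|exact: D_JaV].
  + by rewrite /z /conjg; move: (c) => u; rewrite invgK !mulgA mulgK mulgVK.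
- exists (h * b), (d ^ b); split; last by rewrite /conjg !mulgA mulgK.
  + by apply: (subgroupM sH) => //; exact: stab_b.
  + exact: D_Jb.
- exists (h * b^-1), (d ^ b^-1); split; last by rewrite /conjg invgK !mulgA mulgVK.
  + by apply: (subgroupM sH) => //; exact: (subgroupV sH stab_b).
  + exact: D_JbV.
Qed.

(** The affine action: [g] is the map [u |-> s g * u + delta g], so that
    [delta g] is the image of 0. *)
Variables (s delta : G -> rat).
Hypothesis s_gt0 : forall g, (0 < s g)%R.
Hypothesis sM : forall g h, s (g * h) = (s g * s h)%R.
Hypothesis deltaM : forall g h, delta (g * h) = (delta g + s g * delta h)%R.
Hypotheses (s_a : s a = 1%R) (s_b : s b = 2%R).
Hypotheses (delta_a : delta a = 1%R) (delta_b : delta b = 0%R).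

Let s1 : s 1 = 1%R.
Proof. by apply: (mulfI (lt0r_neq0 (s_gt0 1))); rewrite -sM mulg1 mulr1. Qed.

Let sV g : s g^-1 = (s g)^-1%R.
Proof.
by apply: (mulfI (lt0r_neq0 (s_gt0 g))); rewrite -sM mulgV s1 divff // lt0r_neq0.
Qed.

Let delta1 : delta 1 = 0%R.
Proof. by apply: (addrI (delta 1)); rewrite addr0 -[in RHS](mulg1 1) deltaM s1 mul1r. Qed.

Let deltaV g : delta g^-1 = (- ((s g)^-1 * delta g))%R.
Proof.
apply/eqP; rewrite -subr_eq0 opprK; apply/eqP.
by rewrite -sV -deltaM mulVg delta1.
Qed.

Let s_derived g : derived1 G g -> s g = 1%R.
Proof.
apply: (@subgroup_gen_ind _ _ [set g | s g = 1%R]).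
  split=> [//|x y /= x1 y1|x /= x1]; first by rewrite sM x1 y1 mulr1.
  by rewrite sV x1 invr1.
move=> _ [x _ [y _ <-]] /=; rewrite /commg /conjg !sM !sV.
by have := lt0r_neq0 (s_gt0 x); have := lt0r_neq0 (s_gt0 y) => y0 x0; field; rewrite x0 y0.
Qed.

Let deltaJ u k : derived1 G u -> delta (u ^ k) = ((s k)^-1 * delta u)%R.
Proof.
move=> Gu; rewrite /conjg !deltaM deltaV sV (s_derived Gu) mul1r mulrDr.
by rewrite addrCA addNr addr0.
Qed.

Let delta_c : delta c = 1%R.
Proof.
rewrite /c /twist commgEl deltaM deltaV sV s_a invr1 !mul1r delta_a.
rewrite /conjg !deltaM !deltaV !sV !invrK s_b s_a delta_a delta_b; by field.
Qed.

Lemma stab_delta0 h : stab h -> delta h = 0%R.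
Proof.
apply: (@subgroup_gen_ind _ _ [set g | delta g = 0%R]).
  split=> [//|x y /= x0 y0|x /= x0]; first by rewrite deltaM x0 y0 mulr0 addr0.
  by rewrite deltaV x0 mulr0 oppr0.
have delta_z : delta z = 0%R.
  by rewrite /z deltaM deltaV sV delta_c delta_a s_a; field.
move=> x /=; rewrite !inE => /or3P[] /eqP -> //.
rewrite -/c -/z /conjg invgK deltaM (deltaM z) delta_z deltaV s_a delta_a.
by rewrite /z sM sV s_a (s_derived Gc); field.
Qed.

(** Write [g = h * d] with [h] in [H] and [d] in [D]; if [g] fixes 0, so does [d].
    A conjugate of [d] by a power of [b] is then congruent modulo [H'] to a power
    of [c] that fixes 0. Since [c] moves 0 to 1, that power is trivial. *)
Lemma delta0_stab g :
  subgroup_gen [set x | x = a \/ x = b] g -> delta g = 0%R -> stab g.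
Proof.
move=> /T_all[h [d [Hh [Gd _ [n [v [i [j [Hv Ed]]]]]] ->]]].
rewrite deltaM (stab_delta0 Hh) add0r => /eqP; rewrite mulf_eq0 gt_eqF //= => /eqP d0.
have delta_pow k : delta (c ^+ k) = k%:R%R.
  elim: k => [|k IHk]; first by rewrite expg0.
  by rewrite expgS deltaM delta_c (s_derived Gc) IHk mul1r -natr1 addrC.
have : delta (d ^ b ^- n) = 0%R by rewrite deltaJ // d0 mulr0.
have [Hv1 _] := Hv.
rewrite Ed deltaM (stab_delta0 Hv1) add0r => /eqP.
rewrite mulf_eq0 gt_eqF //= deltaM deltaV (s_derived (Gpow i)) (s_derived (Gpow j)).
rewrite !delta_pow invr1 !mul1r subr_eq0 eqr_nat => /eqP Eij.
move: Ed; rewrite Eij mulgV mulg1 => Ed.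
have Hd : H d.
  rewrite -(conjgKV (b ^+ n) d) Ed; apply: (subgroupJ sH) => //.
  exact: (subgroupX _ sH stab_b).
exact: (subgroupM sH).
Qed.

End Stabiliser.

(** * Density in finite p-groups *)

(** The commutator lies in the Frattini subgroup of the group generated by [x] and
    [y], and elements of the Frattini subgroup are non-generators. *)
Lemma pgroup_frattini (p : nat) (P : finGroupType) (x y : P) :
  p.-group [set: P]%G -> x \in <<[set y; x^-1 * [~ x, y^-1]]%SET>>.
Proof.
move=> pP; set L := <<[set x; y]%SET>>%G; set S := [set y; _]%SET.
have Lx : x \in L by rewrite mem_gen // !inE eqxx.
have Ly : y \in L by rewrite mem_gen // !inE eqxx orbT.
have cL : [~ x, y^-1] \in 'Phi(L).
  have pL : p.-group L by apply: pgroupS pP; exact: finset.subsetT.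
  rewrite (Phi_joing pL) mem_gen // inE; apply/orP; left.
  by rewrite mem_commg // groupV.
have LS : S \subset L.
  apply/fintype.subsetP => u; rewrite !inE => /orP[]/eqP-> //.
  by rewrite groupM ?groupV // (fintype.subsetP (Phi_sub L)).
have genL : 'Phi(L) <*> S = L.
  apply/eqP; rewrite finset.eqEsubset join_subG Phi_sub LS /= gen_subG.
  have Sin u : u \in S -> u \in 'Phi(L) <*> S.
    by move=> Su; apply: (fintype.subsetP (joing_subr _ _)).
  have cin : [~ x, y^-1] \in 'Phi(L) <*> S by apply: (fintype.subsetP (joing_subl _ _)).
  apply/fintype.subsetP => u; rewrite !inE => /orP[]/eqP->; last first.
    by apply: Sin; rewrite !inE eqxx.
  have : [~ x, y^-1] * (x^-1 * [~ x, y^-1])^-1 \in 'Phi(L) <*> S.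
    by rewrite groupM // groupV Sin // !inE eqxx orbT.
  by rewrite invgM invgK mulKVg.
by rewrite (Phi_nongen genL).
Qed.

(** [a] need not lie in the subgroup [stab a b], but its image in a finite p-group
    lies in the image of that subgroup, for every homomorphism. *)
Lemma stab_dense (p : nat) (G : groupType) (a b : G) (P : finGroupType)
    (phi : {multiplicative G -> P}) :
  p.-group [set: P]%G -> (phi @` stab a b) (phi a).
Proof.
move=> pP; have sH := stab_subgroup a b.
pose K : {set P} := [set k | `[< (phi @` stab a b) k >]]%SET.
have gK : group_set K.
  apply/group_setP; split=> [|k k'].
    by rewrite inE; apply/asboolP; exists 1; [exact: subgroup1 sH|exact: gmulf_is1].
  rewrite !inE => -[u Hu <-] [v Hv <-].
  exists (u * v); last exact: gmulfM.
  exact: (subgroupM sH).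
suff: phi a \in Group gK by rewrite inE => /asboolP.
apply: fintype.subsetP (pgroup_frattini (phi a) (phi b) pP); rewrite gen_subG.
apply/fintype.subsetP => u; rewrite finset.in_set2 => /orP[]/eqP->;
  rewrite inE; apply/asboolP.
  by exists b => //; exact: stab_b.
exists (a^-1 * [~ a, b^-1]); first exact: stab_z.
by rewrite /commg /conjg !gmulfM !gmulf_isV.
Qed.

(** * The isolated subgroup that is not separable *)

Lemma noncyclic_basis (G : groupType) (X : Type) (b : X -> G) :
  generates b -> ~ cyclic_group G -> exists x y : X, x <> y.
Proof.
move=> genb ncG; apply: contrapT => Xsub; apply: ncG.
have XX (x y : X) : x = y by apply: contrapT => nxy; apply: Xsub; exists x, y.
have [[x0]|noX] := pselect (inhabited X).
  exists (b x0); apply/seteqP; split=> // g _.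
  apply: (genb _ (subgroup_gen_subgroup _)) => x; rewrite (XX x x0).
  exact: sub_gen_smallest.
exists 1; apply/seteqP; split=> // g _.
apply: (genb _ (subgroup_gen_subgroup _)) => x.
by case: noX; constructor.
Qed.

Theorem mainTheorem2 (p : nat) (Phi : groupType) :
  prime p -> free_metabelian Phi -> ~ cyclic_group Phi ->
  exists H : set Phi,
    [/\ is_subgroup H, finitely_generated H,
        p'_isolated p H & ~ p_separable p H].
Proof.
move=> _ /free_metabelian_basis[X [beta [mPhi genb extb]]] ncPhi.
have [x [y nxy]] := noncyclic_basis genb ncPhi.
have [e expe] := exponent_exists extb.
have [D foxD] := derivation_exists genb extb expe (shift_action X)
  (fun z => single (0%R, z)).
have two_neq0 : (2 : rat) != 0%R by [].
pose dil (f : X -> int) (u : rat) : rat := ((2 : rat) ^ (f y) * u)%R.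
have dil0 u : dil 0%R u = u by rewrite /dil /= expr0z mul1r.
have dilD f g u : dil (f + g)%R u = dil f (dil g u).
  by rewrite /dil /= expfzDr // mulrA.
have dil_add f u v : dil f (u + v)%R = (dil f u + dil f v)%R by rewrite /dil mulrDr.
pose dilation := @LinearAction (X -> int) rat dil dil0 dilD dil_add.
have [delta [delta_b deltaM]] := derivation_exists genb extb expe dilation
  (fun z => if `[< z = x >] then 1%R else 0%R).
pose s g : rat := ((2 : rat) ^ (e g y))%R.
have s_gt0 g : (0 < s g)%R by exact: exprz_gt0.
have sM g h : s (g * h) = (s g * s h)%R by rewrite /s (proj2 expe) expfzDr.
have s_a : s (beta x) = 1%R by rewrite /s (proj1 expe) /single asboolF.
have s_b : s (beta y) = 2%R by rewrite /s (proj1 expe) /single asboolT.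
have delta_a : delta (beta x) = 1%R by rewrite delta_b asboolT.
have delta_b0 : delta (beta y) = 0%R by rewrite delta_b asboolF // => /esym.
set a := beta x in s_a delta_a; set b := beta y in s_b delta_b0.
have stab0 := stab_delta0 s_gt0 sM deltaM s_a s_b delta_a delta_b0.
have stabI := delta0_stab mPhi s_gt0 sM deltaM s_a s_b delta_a delta_b0.
(* the retraction onto the subgroup generated by [a] and [b] *)
have [r rb] := extb Phi (fun z => if `[< z = x >] then a else
                                 if `[< z = y >] then b else 1) mPhi.
have r_a : r a = a by rewrite rb asboolT.
have r_b : r b = b by rewrite rb asboolF ?asboolT // => /esym.
have r_stab h : stab a b h -> r h = h.
  apply: (@subgroup_gen_ind _ _ [set h | r h = h]).
    split=> [|u v /= ru rv|u /= ru]; first exact: gmulf_is1.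
    - by rewrite gmulfM ru rv.
    - by rewrite gmulf_isV ru.
  move=> u /=; rewrite !inE => /or3P[]/eqP-> //;
    by rewrite /twist /commg /conjg !(gmulfM, gmulf_isV, r_a, r_b).
have r_in g : subgroup_gen [set u | u = a \/ u = b] (r g).
  have sS := subgroup_gen_subgroup [set u | u = a \/ u = b].
  apply: (genb _ (preimage_subgroup r sS)) => z /=; rewrite rb.
  do 2?case: asboolP => _; last exact: subgroup1.
    by apply: sub_gen_smallest; left.
  by apply: sub_gen_smallest; right.
exists (stab a b); split.
- exact: stab_subgroup.
- by exists (stab_gens a b).
- move=> q q_pr _ g Hgq.
  have rg : r g = g.
    apply: (unique_roots mPhi genb expe foxD (prime_gt0 q_pr)).
    by rewrite -(r_stab _ Hgq) gmulf_isX.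
  apply: stabI; first by rewrite -rg.
  (* [delta (g^n)] is [1 + s g + ... + (s g)^(n-1)] times [delta g]. *)
  have delta_pow n : exists2 k : rat, (0 <= k)%R &
      delta (g ^+ n.+1) = ((1 + k) * delta g)%R.
    elim: n => [|n [k k_ge0 IHn]]; first by exists 0%R; rewrite // addr0 mul1r.
    exists (s g * (1 + k))%R.
      by rewrite mulr_ge0 ?ltW // ltr_wpDr.
    by rewrite expgS deltaM IHn [RHS]mulrDl mul1r; congr (_ + _)%R; exact: mulrA.
  have [k k_ge0 Ek] := delta_pow q.-1.
  move: (stab0 _ Hgq); rewrite -(prednK (prime_gt0 q_pr)) Ek => /eqP.
  by rewrite mulf_eq0 gt_eqF ?ltr_wpDr //= => /eqP.
- move=> sepH.
  have Ha : ~ stab a b a by move=> /stab0; rewrite delta_a.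
  have [P [phi [pP]]] := sepH a Ha; apply; exact: stab_dense pP.
Qed.
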